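(* Let $p$ be a prime, let $k\ge 1$, let $w\in F_k$ be a word in $k$ variables and let $H_d$ be the free pro-$p$ group of rank $d$. Suppose that the word map $w\colon H_d^k\to H_d$ is not surjective. If $d\ge k+1$, then the image $H_d^{\{w+\}}=\{g\in H_d\mid \exists\,\boldsymbol h\in H_d^k:\ g=w(\boldsymbol h)\}$ of $w$ has Haar measure zero in $H_d$.
   Context: $F_k$ denotes the abstract free group on $k$ generators; an element $w\in F_k$ is called a word in $k$ variables and induces, for each group $G$, a word map $G^k\to G$ by substitution. Every profinite group $G$ carries its unique Haar measure $\mu$ normalised so that $\mu(G)=1$. *)

(* Defs.v *)
From HB Require Import structures.
From mathcomp Require Import all_boot all_order all_algebra.
From mathcomp Require Import all_classical all_reals all_analysis.

Set Implicit Arguments.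
Unset Strict Implicit.
Unset Printing Implicit Defensive.

Local Open Scope classical_set_scope.
Local Open Scope group_scope.

(* The letter (i, false) stands for the generator x_i, and (i, true) for its
   inverse. An element of F_k is represented by its unique reduced word. *)
Definition letter (k : nat) : Type := ('I_k * bool)%type.

Definition invl {k} (a : letter k) : letter k := (a.1, ~~ a.2).

Definition reduced {k} (s : seq (letter k)) : bool :=
  sorted (fun a b => b != invl a) s.

Record free_group (k : nat) := FreeGroup {
  fword :> seq (letter k);
  fwordP : reduced fword
}.

HB.instance Definition _ k := [isSub of free_group k for @fword k].
HB.instance Definition _ k := [Choice of free_group k by <:].

(* The reduced form of a :: s, for a reduced word s. *)
Definition push {k} (a : letter k) (s : seq (letter k)) : seq (letter k) :=
  if s is b :: s' then if b == invl a then s' else a :: s else [:: a].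

Lemma invlK k : involutive (@invl k).
Proof. by case=> i b; rewrite /invl negbK. Qed.

Lemma push_reduced k (a : letter k) s : reduced s -> reduced (push a s).
Proof.
case: s => [|b s] //= rs; case: ifPn => [_|nb]; first exact: path_sorted rs.
by rewrite /reduced /= nb.
Qed.

Lemma pushK k (a : letter k) s : reduced s -> push (invl a) (push a s) = s.
Proof.
case: s => [|b s] /=; first by rewrite invlK eqxx.
case: ifPn => [/eqP -> rs|_ _]; last by rewrite /= invlK eqxx.
by case: s rs => [|c s] //= /andP[/negPf -> _].
Qed.

Definition wmul {k} (s t : seq (letter k)) := foldr push t s.

Lemma wmul_reduced k (s t : seq (letter k)) : reduced t -> reduced (wmul s t).
Proof. by move=> rt; elim: s => //= a s; exact: push_reduced. Qed.

Lemma wmul_push k (a : letter k) s t :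
  reduced t -> wmul (push a s) t = push a (wmul s t).
Proof.
move=> rt; case: s => [|b s] //=; case: ifP => [/eqP ->|] //=.
by rewrite -[X in push X _]invlK pushK // wmul_reduced.
Qed.

Lemma wmulA k (s t u : seq (letter k)) :
  reduced u -> wmul s (wmul t u) = wmul (wmul s t) u.
Proof. by move=> ru; elim: s => //= a s ->; rewrite wmul_push. Qed.

Lemma wmul0 k (s : seq (letter k)) : reduced s -> wmul s [::] = s.
Proof.
elim: s => //= a s IH rs; rewrite IH; last exact: path_sorted rs.
by case: s rs {IH} => //= b s /andP[/negPf ->].
Qed.

Definition winv {k} (s : seq (letter k)) := rev (map invl s).

Lemma winv_reduced k (s : seq (letter k)) : reduced s -> reduced (winv s).
Proof.
rewrite /reduced /winv rev_sorted sorted_map; apply: sub_sorted => a b /=.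
by rewrite invlK; apply: contra => /eqP ->.
Qed.

Lemma wmulV k (s : seq (letter k)) : wmul (winv s) s = [::].
Proof.
elim: s => //= a s IH.
by rewrite /winv map_cons rev_cons /wmul foldr_rcons /= invlK eqxx.
Qed.

Lemma winvK k : involutive (@winv k).
Proof.
move=> s; rewrite /winv map_rev revK -map_comp -[RHS]map_id.
by apply: eq_map => a /=; rewrite invlK.
Qed.

Definition fmul {k} (u v : free_group k) := FreeGroup (wmul_reduced u (fwordP v)).
Definition finv {k} (u : free_group k) := FreeGroup (winv_reduced (fwordP u)).
Definition fone {k} : free_group k := @FreeGroup k [::] isT.

Lemma fmulA k : associative (@fmul k).
Proof. by move=> u v w; apply: val_inj; apply: wmulA; exact: fwordP. Qed.

Lemma fmul1 k : left_id fone (@fmul k).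
Proof. by move=> u; exact: val_inj. Qed.

Lemma fmulr1 k : right_id fone (@fmul k).
Proof. by move=> u; apply: val_inj; apply: wmul0; exact: fwordP. Qed.

Lemma fmulV k : left_inverse fone (@finv k) fmul.
Proof. by move=> u; apply: val_inj; exact: wmulV. Qed.

Lemma fmulrV k : right_inverse fone (@finv k) fmul.
Proof.
by move=> u; apply: val_inj; rewrite /= -{1}[fword u]winvK; exact: wmulV.
Qed.

HB.instance Definition _ k := isGroup.Build (free_group k)
  (@fmulA k) (@fmul1 k) (@fmulr1 k) (@fmulV k) (@fmulrV k).

Definition letter_val {k} {G : groupType} (h : 'I_k -> G) (a : letter k) : G :=
  if a.2 then (h a.1)^-1 else h a.1.

Definition word_map {k} {G : groupType} (w : free_group k) (h : 'I_k -> G) : G :=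
  \prod_(a <- fword w) letter_val h a.

Lemma word_map_morphism k (G : groupType) (h : 'I_k -> G) :
  monoid_morphism (fun w : free_group k => word_map w h).
Proof.
have valV a : letter_val h (invl a) = (letter_val h a)^-1.
  by rewrite /letter_val /=; case: a.2; rewrite /= ?invgK.
split=> [|u v]; first exact: big_nil.
rewrite /word_map /=; elim: (fword u) => [|a s IH] /=.
  by rewrite big_nil mul1g.
rewrite big_cons -mulgA -IH; case: (wmul s v) => [|b t] /=.
  by rewrite big_seq1 big_nil mulg1.
by case: ifP => [/eqP ->|_]; rewrite !big_cons // valV mulVKg.
Qed.

Definition word_image {k} (G : groupType) (w : free_group k) : set G :=
  [set g | exists h : 'I_k -> G, g = word_map w h].
Arguments word_image {k} G w.

(* The base point (irrelevant mathematically) is required by the measurable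
   structure of g_sigma_algebraType. *)
HB.mixin Record isTopologicalGroup G of Group G & PointedTopological G := {
  mulg_continuous : continuous (fun xy : G * G => xy.1 * xy.2);
  invg_continuous : continuous (fun x : G => x^-1)
}.

#[short(type="topGroupType")]
HB.structure Definition TopologicalGroup :=
  {G of Group G & PointedTopological G & isTopologicalGroup G}.

Definition profinite (G : topGroupType) : Prop :=
  [/\ compact [set: G], hausdorff_space G & totally_disconnected [set: G]].

Definition lcoset_set {G : groupType} (x : G) (A : set G) : set G :=
  [set x * y | y in A].

Definition normal_subgroup {G : groupType} (N : set G) : Prop :=
  [/\ N 1, forall x y, N x -> N y -> N (x / y)
    & forall x y, N x -> N (x ^ y)].

Definition has_index {G : groupType} (N : set G) (m : nat) : Prop :=
  (range (fun x => lcoset_set x N) #= `I_m)%card.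

Definition pro_p (p : nat) (G : topGroupType) : Prop :=
  profinite G /\
  forall N : set G, open N -> normal_subgroup N -> exists n, has_index N (p ^ n).

Definition free_pro_p_on (p d : nat) (H : topGroupType) (x : 'I_d -> H) : Prop :=
  pro_p p H /\
  forall G : topGroupType, pro_p p G -> forall f : 'I_d -> G,
    exists! phi : H -> G,
      [/\ continuous phi, monoid_morphism phi & forall i, phi (x i) = f i].

Definition free_pro_p (p d : nat) (H : topGroupType) : Prop :=
  exists x : 'I_d -> H, free_pro_p_on p x.

Notation borel G := (g_sigma_algebraType (@open G)).

(* Left invariance suffices, since compact groups are unimodular. Regularity
   need not be required: free pro-p groups of finite rank are second
   countable, so every Borel probability measure on them is regular. *)
Definition normalized_haar {R : realType} {G : topGroupType}
    (mu : probability (borel G) R) : Prop :=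
  forall (g : G) (A : set (borel G)), measurable A ->
    mu (lcoset_set (g : G) (A : set G)) = mu A.

(* Main.v *)
(* Write e_i for the exponent sums of w. If some e_i is prime to p, then setting
   all other variables to 1 already makes w surjective, because in a pro-p group
   every element is an e_i-th power. So p divides every e_i. Consequently, in a
   p-group G with normal subgroups G = G_1 >= G_2 >= ... satisfying
   [G_m, G] G_m^p <= G_(m+1), the class of w(h) modulo G_(m+1) depends only on
   the classes of the h_i modulo G_m, and for d-generated G the image of w in H_d
   has measure at most |G : G_m|^k / |G : G_(m+1)|. If these quotients were
   bounded below, then log |G : G_m| would be O(m (d-1)^m), as k <= d-1.

   This fails for the group G generated by 1 + X_1, ..., 1 + X_d in the free
   associative F_p-algebra truncated in large degree, where G_m consists of the
   g such that g - 1 has no terms of degree < m. The leading forms of degree m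
   occurring in G_m are closed under bracketing with X_i and [X_1, X_i]. Keep only
   the monomials that start with X_1 X_1: for i <> 1 these brackets then act as
   right multiplications by X_i and [X_1, X_i], which are independent, so the
   space of truncated leading forms has dimension D_m with
   D_(m+2) >= (d-1) (D_(m+1) + D_m), and this grows faster than m (d-1)^m. *)

From HB Require Import structures.
Require Import Defs.
From mathcomp Require Import all_boot all_order all_algebra.
From mathcomp Require Import all_fingroup all_solvable zify ring.
From mathcomp Require Import all_classical all_reals all_analysis.

Set Implicit Arguments.
Unset Strict Implicit.
Unset Printing Implicit Defensive.

(** * The truncated free associative algebra, as matrices indexed by words *)

Section WordMatrices.

Import GRing.Theory.
Local Open Scope ring_scope.

Variables (p n : nat) (I : finType).

Local Notation word := (n.-bseq I).
Local Notation F := 'F_p.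

(* The predecessor makes the matrix size a syntactic successor, so that square
   matrices form a ring with units. *)
Definition wdim : nat := #|{: word}|.-1.

Local Notation M := 'M[F]_wdim.+1.
Local Notation uM := {unit M}.

Lemma wdimS : wdim.+1 = #|{: word}|.
Proof. by rewrite prednK //; apply/card_gt0P; exists [bseq]. Qed.

Definition word_index (a : word) : 'I_wdim.+1 := inord (enum_rank a).
Definition index_word (i : 'I_wdim.+1) : word := nth [bseq] (enum {: word}) i.

Lemma word_indexK : cancel word_index index_word.
Proof.
move=> a; rewrite /index_word /word_index inordK ?nth_enum_rank //.
by rewrite wdimS ltn_ord.
Qed.

Lemma index_wordK : cancel index_word word_index.
Proof.
move=> i; apply: val_inj; rewrite /word_index /index_word /=.
have ltiT : (i < #|{: word}|)%N by rewrite -wdimS.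
rewrite inordK; last by rewrite [X in (_ < X)%N]wdimS ltn_ord.
by rewrite -(enum_val_nth [bseq] (Ordinal ltiT)) enum_valK.
Qed.

(** Matrices act on row vectors indexed by words, so row [[::]] of a right multiplication lists the
    coefficients of the multiplier. Words longer than [n] are read as the empty word by
    [insub_bseq], whence the length bounds in later lemmas. *)
Definition wcoef (A : M) (s t : seq I) : F :=
  A (word_index (insub_bseq n s)) (word_index (insub_bseq n t)).

Lemma insub_bseqK (s : seq I) : (size s <= n)%N -> insub_bseq n s = s :> seq I.
Proof. by move=> sn; rewrite /insub_bseq insubdK. Qed.

Lemma insub_wordK (a : word) : insub_bseq n a = a.
Proof. exact: valKd. Qed.

Lemma wcoefE A (a b : word) : wcoef A a b = A (word_index a) (word_index b).
Proof. by rewrite /wcoef !insub_wordK. Qed.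

Lemma wcoef_inj A B : (forall a b : word, wcoef A a b = wcoef B a b) -> A = B.
Proof.
move=> AB; apply/matrixP=> i j; rewrite -(index_wordK i) -(index_wordK j).
by rewrite -!wcoefE AB.
Qed.

Lemma wcoef0 s t : wcoef 0 s t = 0.
Proof. by rewrite /wcoef mxE. Qed.

Lemma wcoefD A B s t : wcoef (A + B) s t = wcoef A s t + wcoef B s t.
Proof. by rewrite /wcoef mxE. Qed.

Lemma wcoefN A s t : wcoef (- A) s t = - wcoef A s t.
Proof. by rewrite /wcoef mxE. Qed.

Lemma wcoefM A B s t :
  wcoef (A * B) s t = \sum_(c : word) wcoef A s c * wcoef B c t.
Proof.
rewrite /wcoef -[A * B]/(A *m B) mxE (reindex word_index) /=; last first.
  by exists index_word => ? _; [exact: word_indexK | exact: index_wordK].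
by apply: eq_bigr => c _; rewrite insub_wordK.
Qed.

(** In reversed notation, right multiplication by terms of degree at least [m] turns [a] into
    [c ++ a] with [c] of length at least [m]. The condition makes sense for arbitrary matrices, not
    only for those coming from the algebra. *)
Definition filt (m : nat) (A : M) : bool :=
  [forall a : word, forall b : word,
    (wcoef A a b != 0) ==> (suffix a b && (size a + m <= size b)%N)].

Lemma filtP m A : reflect
  (forall a b : word, wcoef A a b != 0 -> suffix a b /\ (size a + m <= size b)%N)
  (filt m A).
Proof.
apply: (iffP forallP) => [fA a b nz|fA a].
  by apply/andP; apply: implyP nz; exact: (forallP (fA a)).
by apply/forallP=> b; apply/implyP=> /fA/andP.
Qed.

Lemma filt0 m : filt m 0.
Proof. by apply/filtP=> a b; rewrite wcoef0 eqxx. Qed.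

Lemma filtD m A B : filt m A -> filt m B -> filt m (A + B).
Proof.
move=> /filtP fA /filtP fB; apply/filtP=> a b; rewrite wcoefD.
have [-> |/fA //] := eqVneq (wcoef A a b) 0.
by rewrite add0r => /fB.
Qed.

Lemma filtN m A : filt m (- A) = filt m A.
Proof.
by apply: eq_forallb => a; apply: eq_forallb => b; rewrite wcoefN oppr_eq0.
Qed.

Lemma filtB m A B : filt m A -> filt m B -> filt m (A - B).
Proof. by move=> fA fB; rewrite filtD ?filtN. Qed.

Lemma filt_subl m A B : filt m (A - B) -> filt m B -> filt m A.
Proof. by move=> fAB fB; rewrite -(subrK B A); exact: filtD. Qed.

Lemma filt_sum m (T : Type) (r : seq T) (P : pred T) (A : T -> M) :
  (forall x, P x -> filt m (A x)) -> filt m (\sum_(x <- r | P x) A x).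
Proof.
move=> fA; elim/big_rec: _ => [|x B Px]; first exact: filt0.
by apply: filtD; exact: fA.
Qed.

Lemma filtM m l A B : filt m A -> filt l B -> filt (m + l) (A * B).
Proof.
move=> /filtP fA /filtP fB; apply/filtP=> a b; rewrite wcoefM => nz.
have [c /andP[Ac Bc]] : exists c : word, (wcoef A a c != 0) && (wcoef B c b != 0).
  apply/existsP; apply: contraR nz => /existsPn no.
  rewrite big1 // => c _; apply/eqP; rewrite mulf_eq0.
  by move: (no c); rewrite negb_and !negbK.
have [sac lac] := fA _ _ Ac; have [scb lcb] := fB _ _ Bc.
by split; [exact: suffix_trans scb | lia].
Qed.

Lemma filt_le m l A : (l <= m)%N -> filt m A -> filt l A.
Proof. by move=> lm /filtP fA; apply/filtP=> a b /fA[-> ?]; split=> //; lia. Qed.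

Lemma filt1 : filt 0 1.
Proof.
apply/filtP=> a b; rewrite wcoefE mxE (can_eq word_indexK).
by case: (a =P b) => [->|]; rewrite ?eqxx // suffix_refl addn0.
Qed.

Lemma filt_big A : filt n.+1 A -> A = 0.
Proof.
move=> /filtP fA; apply: wcoef_inj => a b; rewrite wcoef0.
by apply/eqP; apply/negP=> /negP/fA[_]; have := size_bseq b; lia.
Qed.

Lemma filtX m A j : filt m A -> filt (m * j) (A ^+ j).
Proof.
move=> fA; elim: j => [|j IH]; first by rewrite muln0 filt1.
by rewrite exprS mulnS filtM.
Qed.

(* Monomials are stored in reverse: right multiplication by [letter_mx i]
   prepends [i] to the words indexing the columns. *)
Definition letter_mx (i : I) : M :=
  \matrix_(u, v) (index_word v == i :: index_word u :> seq I)%:R.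

Lemma wcoef_letter i (a b : word) :
  wcoef (letter_mx i) a b = (b == i :: a :> seq I)%:R.
Proof. by rewrite wcoefE mxE !word_indexK. Qed.

Lemma filt_letter i : filt 1 (letter_mx i).
Proof.
apply/filtP=> a b; rewrite wcoef_letter;
  case: (bseqval b =P i :: a) => [->|_]; rewrite ?eqxx // => _.
by rewrite suffix_cons /= addn1; split.
Qed.

(** Column [j :: t] of [letter_mx i] can be nonzero only in row [t], and only for [j = i]. *)
Lemma wcoef_mulr_letter A i j s t : (size t < n)%N -> (size s <= n)%N ->
  wcoef (A * letter_mx i) s (j :: t) = (j == i)%:R * wcoef A s t.
Proof.
move=> tn sn; rewrite -(insub_bseqK (s := j :: t)) // -(insub_bseqK sn).
have tn' := ltnW tn; rewrite wcoefM (bigD1 (insub_bseq n t)) //= big1 => [|c nc].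
  by rewrite wcoef_letter !insub_bseqK // eqseq_cons eqxx andbT addr0 mulrC.
rewrite wcoef_letter !insub_bseqK // eqseq_cons.
case: (t =P c) => [tc|]; last by rewrite andbF mulr0.
by rewrite -val_eqE /= insub_bseqK // tc eqxx in nc.
Qed.

(** Row [s] of [letter_mx i] has its single nonzero entry at [i :: s], a word that survives
    truncation because [size s < n]. *)
Lemma wcoef_mull_letter A i s t : (size s < n)%N -> (size t <= n)%N ->
  wcoef (letter_mx i * A) s t = wcoef A (i :: s) t.
Proof.
move=> sn tn; have sn' := ltnW sn.
rewrite -(insub_bseqK (s := i :: s)) // -(insub_bseqK sn') -(insub_bseqK tn).
rewrite wcoefM (bigD1 (insub_bseq n (i :: s))) //= big1 => [|c nc].
  by rewrite wcoef_letter !insub_bseqK // eqxx mul1r addr0.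
rewrite wcoef_letter insub_bseqK //.
by move: nc; rewrite -val_eqE /= insub_bseqK // => /negPf->; rewrite mul0r.
Qed.

Lemma filt_coef0 m A s t : filt m A -> (size s <= n)%N -> (size t <= n)%N ->
  ~~ suffix s t -> wcoef A s t = 0.
Proof.
move=> /filtP fA sn tn; rewrite -(insub_bseqK sn) -(insub_bseqK tn) => ns.
by apply/eqP; apply: contraR ns => /fA[].
Qed.

Lemma filt_coef_small m A t : filt m A -> (size t < m)%N -> (size t <= n)%N ->
  wcoef A [::] t = 0.
Proof.
move=> /filtP fA sn tn; apply/eqP; move: sn.
rewrite -(insub_bseqK (s := [::]) (leq0n n)) -(insub_bseqK tn) => sn.
apply: contraLR sn => /fA[_]; rewrite insub_bseqK // insub_bseqK // add0n.
by rewrite leqNgt.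
Qed.

(** The power [(- A) ^+ n.+1] lies in degree [n.+1] and vanishes, so a finite geometric series
    inverts [1 + A]. *)
Lemma filt_unit A : filt 1 A -> 1 + A \is a GRing.unit.
Proof.
move=> fA; have := subrX1 (- A) n.+1.
have -> : (- A) ^+ n.+1 = 0.
  apply: filt_big; have /(filtX n.+1) : filt 1 (- A) by rewrite filtN.
  by rewrite mul1n.
rewrite sub0r -(opprD A 1) mulNr => /oppr_inj/esym.
by rewrite addrC => /mulmx1_unit[].
Qed.

Definition letter_unit (i : I) : uM := FinRing.unit M (filt_unit (filt_letter i)).

Lemma val_letter_unit i : val (letter_unit i) = 1 + letter_mx i.
Proof. by []. Qed.

(** Intersected with the group generated by the [1 + X_i], these congruence subgroups give the
    filtration [G_m]. *)
Definition cong_set (m : nat) : {set uM} := [set u : uM | filt m (val u - 1)].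

Lemma cong_group_set m : group_set (cong_set m).
Proof.
apply/group_setP; split=> [|u v]; rewrite !inE; first by rewrite subrr filt0.
move=> fu fv; rewrite FinRing.val_unitM.
have -> : val u * val v - 1 = (val u - 1) * (val v - 1) + (val u - 1) + (val v - 1).
  rewrite -[X in _ + X + _]mulr1 -mulrDr subrK mulrBl mul1r addrA.
  by rewrite subrK.
by do 2![apply: filtD => //]; apply: filt_le (leq_addr m m) (filtM fu fv).
Qed.

Canonical cong_group m : {group uM} := Group (cong_group_set m).

End WordMatrices.

(** * Ring identities for additive commutators *)

Section Commutators.

Import GRing.Theory.
Local Open Scope ring_scope.

Lemma commutator_sub1 (R : pzRingType) (a b : R) :
  (a - 1) * (b - 1) - (b - 1) * (a - 1) = a * b - b * a.
Proof.
have -> c : (a - 1) * c - c * (a - 1) = a * c - c * a.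
  by rewrite mulrBl mul1r mulrBr mulr1 opprB addrA subrK.
by rewrite mulrBr mulr1 mulrBl mul1r opprB addrA subrK.
Qed.

Lemma commutator_diff (R : pzRingType) (a a' b b' : R) :
  a' * b' - b' * a' - (a * b - b * a)
    = (a' - a) * b' + a * (b' - b) - ((b' - b) * a' + b * (a' - a)).
Proof.
have H (c c' e e' : R) : (c' - c) * e' + c * (e' - e) = c' * e' - c * e.
  by rewrite mulrBl mulrBr addrA subrK.
by rewrite !H opprD addrACA -opprD.
Qed.

End Commutators.

(** * Congruence subgroups: words, p-th powers and commutators modulo higher degree *)

Section CongruenceSubgroups.

Import GRing.Theory.
Local Open Scope ring_scope.

Variables (p n : nat) (I : finType).
Hypothesis p_pr : prime p.

Local Notation M := 'M['F_p]_((wdim n I).+1).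
Local Notation uM := {unit M}.
Local Notation filt := (@filt p n I).
Local Notation U := (@cong_group p n I).

Implicit Types (A B D : M) (u v : uM).

Lemma filt_near1 A : filt 1 (A - 1) -> filt 0 A.
Proof. by move=> fA; rewrite -(subrK 1 A) filtD ?filt1 // (filt_le (leq0n 1)). Qed.

(** Factors congruent to 1 do not change leading terms: [A D B - D = (A - 1) D B + D (B - 1)], and
    both summands gain a degree. *)
Lemma filt_mul_near1 m A B : filt 1 (A - 1) -> filt 1 (B - 1) ->
  forall D, filt m D -> filt m.+1 (A * D * B - D).
Proof.
move=> fA fB D fD.
have -> : A * D * B - D = (A - 1) * D * B + D * (B - 1).
  by rewrite mulrBl mul1r mulrBl mulrBr mulr1 addrA subrK.
have := filtM (filtM fA fD) (filt_near1 fB); rewrite addn0 add1n => fADB.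
by rewrite filtD // -addn1 filtM.
Qed.

Lemma cong_big : U n.+1 = 1%G.
Proof.
apply/trivGP/fintype.subsetP=> u; rewrite !inE => /filt_big/eqP;
rewrite subr_eq0 => /eqP u1.
by rewrite -val_eqE /= u1.
Qed.

Lemma cong1V u : u \in U 1 -> filt 1 (val (u^-1)%g - 1).
Proof. by move=> uU; have := groupVr uU; rewrite inE. Qed.

Lemma mem_lcoset_cong m u v : u \in U 1 ->
  (v \in u *: U m)%g = filt m (val v - val u).
Proof.
move=> uU; rewrite mem_lcoset inE FinRing.val_unitM.
have fu : filt 0 (val u) by move: uU; rewrite inE => /filt_near1.
have fV := filt_near1 (cong1V uU).
have uV : val u * val (u^-1)%g = 1 by rewrite -FinRing.val_unitM mulgV.
have Vu : val (u^-1)%g * val u = 1 by rewrite -FinRing.val_unitM mulVg.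
apply/idP/idP => [f|f].
  have := filtM fu f; rewrite add0n mulrBr mulrA uV mulr1 mul1r; exact.
by have := filtM fV f; rewrite add0n mulrBr Vu.
Qed.

(** To first order inversion negates a difference, since [v^-1 - u^-1 = - v^-1 (v - u) u^-1] and the
    outer factors are congruent to 1. *)
Lemma filt_inv_diff m u v : u \in U 1 -> v \in U 1 -> filt m (val v - val u) ->
  filt m.+1 (val (v^-1)%g - val (u^-1)%g + (val v - val u)).
Proof.
move=> uU vU /(filt_mul_near1 (cong1V vU) (cong1V uU)).
rewrite mulrBr mulrBl -!FinRing.val_unitM mulVg mul1g mulgK.
by rewrite -filtN opprB opprB addrC.
Qed.

Lemma filt_mul_diff m A A' B B' :
  filt 1 (A - 1) -> filt 1 (B' - 1) -> filt m (A' - A) -> filt m (B' - B) ->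
  filt m.+1 (A' * B' - A * B - (A' - A + (B' - B))).
Proof.
move=> fA fB fA' fB'.
have -> : A' * B' - A * B - (A' - A + (B' - B))
    = (A' - A) * (B' - 1) + (A - 1) * (B' - B).
  rewrite mulrBr mulr1 !mulrBl mul1r mulrBr [RHS]addrACA -opprD.
  by rewrite [in RHS]addrA subrK.
by apply: filtD; [rewrite -addn1 | rewrite -add1n]; exact: filtM.
Qed.

(** To first order a word is additive: its value changes by the signed sum of the changes of its
    letters. This follows letter by letter from the rules for products and inverses. *)
Lemma word_diff k m (h h' : 'I_k -> uM) (s : seq (letter k)) :
  (forall i, h i \in U 1) -> (forall i, h' i \in U 1) ->
  (forall i, filt m (val (h' i) - val (h i))) ->
  filt m.+1 (val (\prod_(a <- s) letter_val h' a)%g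
    - val (\prod_(a <- s) letter_val h a)%g
    - \sum_(a <- s) (if a.2 then - (val (h' a.1) - val (h a.1))
                     else val (h' a.1) - val (h a.1))).
Proof.
move=> hU h'U hh'; pose D i := val (h' i) - val (h i).
have lU g (a : letter k) : (forall i, g i \in U 1) -> letter_val g a \in U 1.
  by rewrite /letter_val => gU; case: a.2; rewrite ?groupV.
have ldiff a : filt m.+1 (val (letter_val h' a) - val (letter_val h a)
    - if a.2 then - D a.1 else D a.1).
  rewrite /letter_val; case: a.2; last by rewrite subrr filt0.
  by rewrite opprK filt_inv_diff.
have lm a : filt m (val (letter_val h' a) - val (letter_val h a)).
  rewrite -[X in filt m X](subrK (if a.2 then - D a.1 else D a.1)) filtD //.
    exact: filt_le (ldiff a).
  by case: a.2; rewrite ?filtN hh'.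
elim: s => [|a s IH]; first by rewrite !big_nil !subrr filt0.
rewrite !big_cons; set P' := (\prod_(_ <- _) letter_val h' _)%g in IH *.
set P := (\prod_(_ <- _) letter_val h _)%g in IH *; set S := \sum_(_ <- _) _ in IH *.
have P'U : P' \in U 1.
  by rewrite /P'; elim/big_rec: _ => [|b x _ xU]; rewrite ?group1 // groupM // lU.
have fS : filt m S by apply: filt_sum => b _; case: b.2; rewrite ?filtN hh'.
have fP : filt m (val P' - val P).
  by rewrite -[X in filt m X](subrK S) filtD // (filt_le _ IH).
have fa : filt 1 (val (letter_val h a) - 1) by have := lU h a hU; rewrite inE.
have fP' : filt 1 (val P' - 1) by rewrite inE in P'U.
have := filtD (filt_mul_diff fa fP' (lm a) fP) (filtD (ldiff a) IH).
by rewrite [X in _ + X]addrACA -opprD addrA subrK.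
Qed.

Definition exponent_sum k (w : seq (letter k)) (i : 'I_k) : int :=
  \sum_(a <- w | a.1 == i) (if a.2 then -1 else 1).

Lemma mulrz_Fp A (e : int) : (p %| e)%Z -> A *~ e = 0.
Proof.
case/dvdzP=> z ->; rewrite mulrC mulrzA -[A *~ p]/(A *+ p).
by rewrite -(scaler_nat p A) pchar_Fp_0 // scale0r mul0rz.
Qed.

Lemma sum_letters k (w : seq (letter k)) (D : 'I_k -> M) :
  \sum_(a <- w) (if a.2 then - D a.1 else D a.1)
    = \sum_i D i *~ exponent_sum w i.
Proof.
rewrite (eq_bigr (fun i => \sum_(a <- w | a.1 == i) D i *~ (if a.2 then -1 else 1))).
  rewrite (exchange_big_dep predT) //=; apply: eq_bigr => a _.
  by rewrite (big_pred1 a.1) => [|i]; [case: a.2; rewrite ?mulrNz | rewrite eq_sym].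
by move=> i _; rewrite mulrz_sumr.
Qed.

(** The first-order change of the value is the sum of the changes of the variables weighted by the
    exponent sums. It vanishes in characteristic [p], so one degree is gained. *)
Lemma word_map_cong k m (w : free_group k) (h h' : 'I_k -> uM) :
  (forall i, p %| exponent_sum w i)%Z ->
  (forall i, h i \in U 1) -> (forall i, h' i \in U 1) ->
  (forall i, h' i \in h i *: U m)%g ->
  (word_map w h' \in word_map w h *: U m.+1)%g.
Proof.
move=> pw hU h'U hh'; rewrite mem_lcoset_cong; last first.
  rewrite /word_map; elim/big_rec: _ => [|a x _ xU]; first exact: group1.
  by rewrite groupM // /letter_val; case: a.2; rewrite ?groupV.
have := @word_diff _ m h h' w hU h'U.
rewrite (sum_letters w (fun i => val (h' i) - val (h i))).
rewrite [X in _ - X]big1 ?subr0 => [|i _]; last exact: mulrz_Fp (pw i).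
by apply=> i; rewrite -mem_lcoset_cong.
Qed.

(** For [u = 1 + a] one has [u ^ j = 1 + j a] up to terms of degree at least [2 m], and
    [2 m >= m + 1]; then [j = p] kills the linear term. *)
Lemma cong_expp m u : (0 < m)%N -> u \in U m -> (u ^+ p)%g \in U m.+1.
Proof.
move=> m0 uU.
have f1 : filt m (val u - 1) by rewrite inE in uU.
have H j : filt m.+1 (val (u ^+ j)%g - 1 - (val u - 1) *+ j).
  elim: j => [|j IH]; first by rewrite expg0 mulr0n subrr subr0 filt0.
  have fj : filt m (val (u ^+ j)%g - 1) by have := groupX j uU; rewrite inE.
  rewrite expgS FinRing.val_unitM mulrS.
  have -> : val u * val (u ^+ j)%g - 1 - (val u - 1 + (val u - 1) *+ j)
      = (val u - 1) * (val (u ^+ j)%g - 1) + (val (u ^+ j)%g - 1 - (val u - 1) *+ j).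
    rewrite mulrBr mulr1 [in RHS]mulrBl mul1r opprD addrA [RHS]addrA.
    by congr (_ - _); rewrite [RHS]addrAC addrA subrK.
  by rewrite filtD // (filt_le _ (filtM f1 fj)) //; lia.
by have := H p; rewrite -(scaler_nat p) pchar_Fp_0 // scale0r subr0 inE.
Qed.

(** Each p-th power climbs one degree, so after [n] of them [U n.+1 = 1] is reached and the exponent
    divides [p ^ n]. *)
Lemma cong_pgroup : p.-group%g (U 1).
Proof.
have H j u : u \in U 1 -> (u ^+ (p ^ j))%g \in U j.+1.
  move=> uU; elim: j => [|j IH]; first by rewrite expn0 expg1.
  by rewrite expnSr expgM cong_expp.
rewrite -pnat_exponent; apply: (@pnat_dvd _ (p ^ n)%N); last by rewrite pnatX pnat_id.
by apply/exponentP=> u /(H n); rewrite cong_big inE => /eqP.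
Qed.

(** Group commutators have Lie brackets as leading forms: [[u, v] - 1] is [(v u)^-1] times the
    bracket of [u - 1] and [v - 1], and the factor congruent to 1 is invisible in leading degree. *)
Lemma cong_commg a b u v A B : (0 < a)%N -> (0 < b)%N ->
  filt a A -> filt b B ->
  filt a.+1 (val u - 1 - A) -> filt b.+1 (val v - 1 - B) ->
  filt (a + b).+1 (val [~ u, v]%g - 1 - (A * B - B * A)).
Proof.
move=> a0 b0 fA fB fuA fvB.
have fu : filt a (val u - 1).
  by rewrite -(subrK A (val u - 1)) filtD // (filt_le _ fuA).
have fv : filt b (val v - 1).
  by rewrite -(subrK B (val v - 1)) filtD // (filt_le _ fvB).
set u1 := val u - 1 in fu fuA; set v1 := val v - 1 in fv fvB.
have uU : u \in U 1 by rewrite inE (filt_le _ fu).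
have vU : v \in U 1 by rewrite inE (filt_le _ fv).
have E : val [~ u, v]%g - 1 = val ((v * u)^-1)%g * (u1 * v1 - v1 * u1) * 1.
  have -> : u1 * v1 - v1 * u1 = val (u * v)%g - val (v * u)%g.
    by rewrite !FinRing.val_unitM; exact: commutator_sub1.
  rewrite mulr1 mulrBr -!FinRing.val_unitM mulVg; congr (val _ - _).
  by rewrite commgEl conjgE !invMg -!mulgA.
have fuv : filt (a + b) (u1 * v1 - v1 * u1) by apply: filtB; [|rewrite addnC]; exact: filtM.
have f11 : filt 1 (1 - 1 : M) by rewrite subrr filt0.
have := filt_mul_near1 (cong1V (groupM vU uU)) f11 fuv.
rewrite -E => f1.
rewrite -(subrK (u1 * v1 - v1 * u1) (val _ - 1)) -addrA filtD //.
have -> : u1 * v1 - v1 * u1 - (A * B - B * A) =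
   (u1 - A) * v1 + A * (v1 - B) - ((v1 - B) * u1 + B * (u1 - A)).
  exact: commutator_diff.
apply: filtB; apply: filtD.
- exact: filtM fuA fv.
- by rewrite -addnS; exact: filtM.
- by rewrite addnC -addSn; exact: filtM.
- by rewrite addnC -addnS; exact: filtM.
Qed.

End CongruenceSubgroups.

(** * The group generated by the [1 + X_i] and its truncated leading forms *)

Section LetterGroup.

Import GRing.Theory.
Local Open Scope ring_scope.

Variables (p n : nat) (I : finType) (x : I).

Local Notation M := 'M['F_p]_((wdim n I).+1).
Local Notation uM := {unit M}.
Local Notation filt := (@filt p n I).
Local Notation U := (@cong_group p n I).
Local Notation X := (@letter_mx p n I).
Local Notation gX := (@letter_unit p n I).

Definition letter_group : {group uM} := (<<[set gX i | i : I]>>)%G.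

Local Notation G := letter_group.

Lemma letter_unitB1 i : val (gX i) - 1 = X i.
Proof. by rewrite val_letter_unit addrAC subrr add0r. Qed.

Lemma letter_unit_cong i : gX i \in U 1.
Proof. by rewrite inE letter_unitB1 filt_letter. Qed.

Lemma letter_unit_in i : gX i \in G.
Proof. by rewrite mem_gen // imset_f. Qed.

Lemma letter_group_cong : (G \subset U 1)%g.
Proof.
by rewrite gen_subG; apply/fintype.subsetP=> _ /imsetP[i _ ->]; exact: letter_unit_cong.
Qed.

(** The part of the degree [l + 2] form of [u - 1] on monomials that start with [X_x X_x]; reversal
    puts these two letters at the end. Here [x] is the distinguished letter. *)
Definition leading l (u : uM) : {ffun l.-tuple I -> 'F_p} :=
  [ffun s : l.-tuple I => wcoef (val u - 1) [::] (s ++ [:: x; x])].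

Definition leading_set l : {set {ffun l.-tuple I -> 'F_p}} :=
  [set leading l u | u in G :&: U l.+2].

Lemma leading_congr l u (A : M) : (l.+2 <= n)%N -> filt l.+3 (val u - 1 - A) ->
  leading l u = [ffun s : l.-tuple I => wcoef A [::] (s ++ [:: x; x])].
Proof.
move=> ln fuA; apply/ffunP=> s; rewrite !ffunE; apply/eqP.
rewrite -subr_eq0 -wcoefN -wcoefD; apply/eqP.
by apply: filt_coef_small fuA _ _; rewrite size_cat size_tuple addn2.
Qed.

Lemma leading_set0 l : 0 \in leading_set l.
Proof.
apply/imsetP; exists 1%g; first by rewrite group1.
by apply/ffunP=> s; rewrite !ffunE subrr wcoef0.
Qed.

(** Products of group elements add leading forms: the error [(u - 1) (v - 1)] has degree at least
    [2 (l + 2)], beyond [l + 2]. *)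
Lemma leading_setD l f g : (l.+2 <= n)%N ->
  f \in leading_set l -> g \in leading_set l -> f + g \in leading_set l.
Proof.
move=> ln /imsetP[u /setIP[uG uU] ->] /imsetP[v /setIP[vG vU] ->].
apply/imsetP; exists (u * v)%g; first by apply/setIP; split; exact: groupM.
rewrite (@leading_congr _ (u * v)%g (val u - 1 + (val v - 1))) //.
  by apply/ffunP=> s; rewrite !ffunE [RHS]wcoefD.
have -> : val (u * v)%g - 1 - (val u - 1 + (val v - 1)) = (val u - 1) * (val v - 1).
  rewrite FinRing.val_unitM [val u - 1 + _]addrC opprD addrA.
  rewrite [in RHS]mulrBr mulr1 mulrBl mul1r; congr (_ - _).
  by rewrite -addrA -opprD [1 + _]addrC subrK.
rewrite !inE in uU vU; apply: filt_le (filtM uU vU); lia.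
Qed.

Lemma leading_set_sum l (T : Type) (r : seq T) (P : pred T)
    (f : T -> {ffun l.-tuple I -> 'F_p}) : (l.+2 <= n)%N ->
  (forall i, P i -> f i \in leading_set l) ->
  \sum_(i <- r | P i) f i \in leading_set l.
Proof.
move=> ln fl; elim/big_rec: _ => [|i g Pi gl]; first exact: leading_set0.
by rewrite leading_setD // fl.
Qed.

(** Right multiplication by [X_i] on truncated forms. *)
Definition ad_letter l i (f : {ffun l.-tuple I -> 'F_p}) : {ffun l.+1.-tuple I -> 'F_p} :=
  [ffun s : l.+1.-tuple I => (thead s == i)%:R * f (behead_tuple s)].

Lemma not_suffix_xx i (s : seq I) : i != x -> ~~ suffix [:: i] (s ++ [:: x; x]).
Proof.
move=> ix; rewrite -(cat1s x) catA !cats1.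
by rewrite (suffix_rcons [::] (rcons s x) i x) negb_and ix.
Qed.

(* Since [i != x], the term [X_i u] of the bracket [u X_i - X_i u] has no monomial
   ending, in reversed notation, with [x x]. *)
Lemma leading_set_ad l i f : (l.+3 <= n)%N -> i != x ->
  f \in leading_set l -> ad_letter i f \in leading_set l.+1.
Proof.
move=> ln ix /imsetP[u /setIP[uG uU] ->].
have uU2 := uU; rewrite inE in uU2.
have fiX : filt 2 (val (gX i) - 1 - X i).
  by rewrite letter_unitB1 subrr filt0.
have fuu : filt l.+3 (val u - 1 - (val u - 1)) by rewrite subrr filt0.
have fc := cong_commg (isT : (0 < l.+2)%N) (isT : (0 < 1)%N) uU2 (filt_letter p n i) fuu fiX.
rewrite addn1 in fc.
apply/imsetP; exists [~ u, gX i]%g.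
  apply/setIP; split; first by rewrite groupR // letter_unit_in.
  rewrite inE; apply: filt_subl (filt_le (leqnSn _) fc) _.
  by apply: filtB; [rewrite -addn1 | rewrite -add1n];
    apply: filtM => //; exact: filt_letter.
rewrite (leading_congr _ fc) //; apply/ffunP=> s; rewrite !ffunE [RHS]wcoefD wcoefN.
have st : size (s ++ [:: x; x]) = l.+3 by rewrite size_cat size_tuple addn2.
rewrite wcoef_mull_letter ?st //; last by rewrite (leq_trans _ ln).
rewrite (filt_coef0 (s := [:: i]) uU2) ?st ?not_suffix_xx ?subr0 //; last exact: leq_trans ln.
case/tupleP: s st => a s /= [st].
by rewrite theadE wcoef_mulr_letter // st.
Qed.

(** Right multiplication by [X_x X_i - X_i X_x], with each monomial read backwards. *)
Definition ad_pair l i (f : {ffun l.-tuple I -> 'F_p}) : {ffun l.+2.-tuple I -> 'F_p} :=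
  [ffun s : l.+2.-tuple I =>
     ((thead s == i) && (thead (behead_tuple s) == x))%:R
       * f (behead_tuple (behead_tuple s))
     - ((thead s == x) && (thead (behead_tuple s) == i))%:R
       * f (behead_tuple (behead_tuple s))].

Lemma letter_comm_cong i j :
  filt 3 (val [~ gX i, gX j]%g - 1 - (X i * X j - X j * X i)).
Proof.
by apply: (@cong_commg _ _ _ 1 1); rewrite ?filt_letter // letter_unitB1 subrr filt0.
Qed.

Lemma filt_letter_comm i j : filt 2 (X i * X j - X j * X i).
Proof. by apply: filtB; apply: (@filtM _ _ _ 1 1); exact: filt_letter. Qed.

Lemma not_suffix_pair i j (s : seq I) : (i != x) || (j != x) ->
  ~~ suffix [:: i; j] (s ++ [:: x; x]).
Proof.
move=> ijx; rewrite -(cat1s x) catA !cats1.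
rewrite (suffix_rcons [:: i] (rcons s x) j x) (suffix_rcons [::] s i x).
by rewrite suffix0s andbT andbC negb_and.
Qed.

(** In the bracket of [u - 1] with [Z = X_x X_i - X_i X_x], the monomials of [Z (u - 1)] start with
    two distinct letters, so only [(u - 1) Z] contributes to the truncated form. *)
Lemma leading_set_ad_pair l i f : (l.+4 <= n)%N -> i != x ->
  f \in leading_set l -> ad_pair i f \in leading_set l.+2.
Proof.
move=> ln ix /imsetP[u /setIP[uG uU] ->].
have uU2 := uU; rewrite inE in uU2.
have fuu : filt l.+3 (val u - 1 - (val u - 1)) by rewrite subrr filt0.
have fc := cong_commg (isT : (0 < l.+2)%N) (isT : (0 < 2)%N) uU2 (filt_letter_comm x i)
  fuu (letter_comm_cong x i).
rewrite addn2 in fc; set Z := X x * X i - X i * X x in fc.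
apply/imsetP; exists [~ u, [~ gX x, gX i]]%g.
  apply/setIP; split; first by rewrite !groupR // letter_unit_in.
  rewrite inE; apply: filt_subl (filt_le (leqnSn _) fc) _.
  by apply: filtB; [rewrite -addn2 | rewrite -add2n];
    apply: filtM => //; exact: filt_letter_comm.
rewrite (leading_congr _ fc) //; apply/ffunP=> s; rewrite !ffunE [RHS]wcoefD wcoefN.
have st : size (s ++ [:: x; x]) = l.+4 by rewrite size_cat size_tuple addn2.
have n1 : (0 < n)%N by exact: leq_trans ln.
have n2 : (1 < n)%N by exact: leq_trans ln.
have sn : (size (s ++ [:: x; x]) <= n)%N by rewrite st.
have -> : wcoef (Z * (val u - 1)) [::] (s ++ [:: x; x]) = 0.
  rewrite /Z [LHS]/= mulrBl wcoefD wcoefN -!mulrA !wcoef_mull_letter //.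
  rewrite (filt_coef0 (s := [:: i; x]) uU2) ?not_suffix_pair ?ix //.
  by rewrite (filt_coef0 (s := [:: x; i]) uU2) ?not_suffix_pair ?ix ?orbT ?subr0.
rewrite subr0 /Z mulrBr [RHS]wcoefD wcoefN !mulrA.
case/tupleP: s st sn => a s; case/tupleP: s => b s /= [st] sn.
rewrite !theadE /= !wcoef_mulr_letter ?st //; try exact: ltnW.
by rewrite !mulrA -!natrM !mulnb.
Qed.

End LetterGroup.

(** * Recursive growth of the sets of leading forms *)

Section LetterGroupOrder.

Import GRing.Theory.
Local Open Scope ring_scope.

Variables (p n : nat) (I : finType) (x : I).

Local Notation W l := (@leading_set p n I x l).
Local Notation V l := {ffun l.-tuple I -> 'F_p}.

(** The recursion for [D_m] in terms of cardinalities: families of forms indexed by the letters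
    other than [x] are sent injectively by [Phi] to sums of their brackets. *)
Lemma card_leading_set_step l : (l.+4 <= n)%N ->
  (#|W l.+1| ^ #|I|.-1 * #|W l| ^ #|I|.-1 <= #|W l.+2|)%N.
Proof.
move=> ln; pose J := {i : I | i != x}.
have <- : #|{: J}| = #|I|.-1 by rewrite card_sig cardC1.
pose D := finset.setX [set a : {ffun J -> V l.+1} | a \in ffun_on (mem (W l.+1))]
               [set b : {ffun J -> V l} | b \in ffun_on (mem (W l))].
pose Phi (ab : {ffun J -> V l.+1} * {ffun J -> V l}) : V l.+2 :=
  \sum_(i : J) (ad_letter (val i) (ab.1 i) + ad_pair x (val i) (ab.2 i)).
have -> : (#|W l.+1| ^ #|{: J}| * #|W l| ^ #|{: J}|)%N = #|D|.
  by rewrite cardsX !cardsE !card_ffun_on.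
have ad_letterE (j : I) (f : V l.+1) y (s : l.+1.-tuple I) :
    ad_letter j f [tuple of y :: s] = (y == j)%:R * f s.
  by rewrite ffunE theadE; congr (_ * f _); apply: val_inj.
have ad_pairE (j : I) (f : V l) y z (s : l.-tuple I) :
    ad_pair x j f [tuple of y :: [tuple of z :: s]]
      = ((y == j) && (z == x))%:R * f s - ((y == x) && (z == j))%:R * f s.
  have st : behead_tuple [tuple of y :: [tuple of z :: s]] = [tuple of z :: s].
    exact: val_inj.
  have tt : behead_tuple [tuple of z :: s] = s by exact: val_inj.
  by rewrite ffunE st tt !theadE.
have xJ (j : J) : (x == val j) = false by rewrite eq_sym (negPf (valP j)).
have neJ (i j : J) : j != i -> (val i == val j) = false.
  by move=> /negPf ji; rewrite (inj_eq val_inj) eq_sym.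
(* The values at the words [x :: i :: s] determine [b], and then those at the
   words [i :: t] determine [a]. *)
have Phi_inj : injective Phi.
  move=> [a b] [a' b'] E; have Eb : b = b'.
    apply/ffunP=> i; apply/ffunP=> s.
    have K c e : Phi (c, e) [tuple of x :: [tuple of val i :: s]] = - e i s.
      rewrite /Phi sum_ffunE (bigD1 i) //= big1 => [|j ji].
        rewrite ffunE ad_letterE ad_pairE xJ !eqxx.
        by rewrite !mul0r mul1r sub0r add0r addr0.
      rewrite ffunE ad_letterE ad_pairE xJ neJ // andbF.
      by rewrite !mul0r subrr addr0.
    by apply: oppr_inj; rewrite -(K a) -(K a') E.
  congr (_, _) => //; apply/ffunP=> i; apply/ffunP=> t.
  have K (c : {ffun J -> V l.+1}) :
      (\sum_j ad_letter (val j) (c j)) [tuple of val i :: t] = c i t.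
    rewrite sum_ffunE (bigD1 i) //= big1 => [|j ji].
      by rewrite ad_letterE eqxx mul1r addr0.
    by rewrite ad_letterE neJ // mul0r.
  by move: E; rewrite /Phi Eb !big_split /= => /addIr E; rewrite -!K E.
rewrite -(card_imset _ Phi_inj); apply: subset_leq_card.
apply/fintype.subsetP=> y /imsetP[[a b]]; rewrite inE /= !inE.
case/andP=> /ffun_onP aW /ffun_onP bW ->.
apply: leading_set_sum => // i _; apply: leading_setD => //.
  by apply: leading_set_ad (valP i) (aW i).
by apply: leading_set_ad_pair (valP i) (bW i).
Qed.

(** The seed of the recursion: the commutator of [x] with [[x, i]] has coefficient 1 at
    [X_x X_x X_i], hence a nonzero truncated form. *)
Lemma card_leading_set1 : (3 <= n)%N -> (1 < #|I|)%N -> (1 < #|W 1|)%N.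
Proof.
move=> n3 I2; have [i ix] : exists i : I, i != x.
  have /card_gt0P[i] : (0 < #|predC1 x|)%N by rewrite cardC1 -ltnS prednK // ltnW.
  by rewrite !inE; exists i.
pose X := @letter_mx p n I; pose Z := X x * X i - X i * X x.
pose u := [~ letter_unit p n x, [~ letter_unit p n x, letter_unit p n i]]%g.
have fx : filt 2 (val (letter_unit p n x) - 1 - X x).
  by rewrite letter_unitB1 subrr filt0.
have fu : filt 4 (val u - 1 - (X x * Z - Z * X x)).
  exact: (@cong_commg _ _ _ 1 2) (filt_letter _ _ _) (filt_letter_comm _ _ _ _)
    fx (letter_comm_cong _ _ _ _).
have uU : u \in @cong_group p n I 3.
  rewrite inE; apply: filt_subl (filt_le _ fu) _ => //.
  by apply: filtB; [apply: (@filtM _ _ _ 1 2) | apply: (@filtM _ _ _ 2 1)];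
    rewrite ?filt_letter ?filt_letter_comm.
have fW : leading x 1 u \in W 1.
  by apply: imset_f; apply/setIP; split; rewrite // !groupR // letter_unit_in.
have f1 : leading x 1 u [tuple i] = 1.
  have n2 : (1 < n)%N by exact: ltnW.
  have n1 : (0 < n)%N by exact: ltnW.
  rewrite (leading_congr x n3 fu) ffunE [LHS]wcoefD wcoefN /Z mulrBr.
  rewrite [X in X - _]wcoefD wcoefN !mulrA !wcoef_mulr_letter //.
  rewrite [x == i]eq_sym (negPf ix) !mul0r !subr0 eqxx mul1r -[X x]mul1r.
  rewrite !wcoef_mulr_letter // eqxx !mul1r.
  by rewrite /wcoef mxE eqxx.
rewrite (cardD1 (0 : V 1)) leading_set0 (cardD1 (leading x 1 u)) !inE fW andbT.
case: eqP => // f0; have := f1; rewrite f0 ffunE => /esym/eqP.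
by rewrite oner_eq0.
Qed.

End LetterGroupOrder.

(** * Lower bound for the order of the group *)

Section LowerBound.

(** The extremal solution of the recursion for [D_m] with [q = d - 1], the index being shifted by 2
    from the degree. *)
Fixpoint qfib (q l : nat) : nat :=
  if l is l1.+1 then if l1 is l2.+1 then q * (qfib q l1 + qfib q l2) else 1 else 0.

Lemma qfibSS q l : qfib q l.+2 = q * (qfib q l.+1 + qfib q l).
Proof. by []. Qed.

Lemma nat_two_step_ind (P : nat -> Prop) :
  P 0 -> P 1 -> (forall l, P l -> P l.+1 -> P l.+2) -> forall l, P l.
Proof.
move=> P0 P1 PS l; suff [] : P l /\ P l.+1 by [].
by elim: l => [|l [Pl PSl]]; split => //; exact: PS.
Qed.

(** Three passes through the recursion. Each one inserts the previous bound into the older term and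
    raises the degree of the polynomial factor in front of [q ^ l] by one: constant, linear,
    quadratic. A quadratic factor beats the linear one of the upper bound. *)
Lemma qfib_lower q l : 0 < q -> 'C(l.-1, 2) * q ^ l <= q ^ 2 * qfib q l.+1.
Proof.
move=> q0.
have H0 : forall l, q ^ l <= qfib q l.+1.
  elim/nat_two_step_ind=> [||{}l IH1 IH2] //; first by rewrite /= expn1 addn0 muln1.
  by rewrite qfibSS [q ^ _]expnS leq_mul2l (leq_trans IH2) ?orbT // leq_addr.
have H1 : forall l, l * q ^ l <= q * qfib q l.+1.
  elim/nat_two_step_ind=> [||{}l IH1 IH2] //.
    by rewrite mul1n expn1 /= addn0 muln1 leq_pmulr.
  rewrite qfibSS mulSn addnC [q ^ _]expnS mulnCA -mulnDr leq_mul2l mulnDr.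
  by rewrite leq_add ?orbT // expnS leq_mul2l H0 orbT.
elim/nat_two_step_ind: l => [||l IH1 IH2] //.
rewrite qfibSS [l.+2.-1]/= binS bin1 mulnDl [X in _ <= _ * X]mulnDr mulnDr.
apply: leq_add; first by rewrite expnS mulnCA [X in _ <= X]mulnCA leq_mul2l IH2 orbT.
by rewrite expnS mulnCA expnS [X in q * X]mulnCA mulnA mulnn leq_mul2l H1 orbT.
Qed.

Lemma card_leading_set p n (I : finType) (x : I) l : (l.+2 <= n) ->
  1 < #|I| -> 2 ^ qfib #|I|.-1 l <= #|leading_set p n x l|.
Proof.
move=> ln I2; elim/nat_two_step_ind: l ln => [|ln|l IH1 IH2 ln].
- by move=> _; rewrite expn0; apply/card_gt0P; exists 0%R; exact: leading_set0.
- by rewrite expn1; apply: card_leading_set1.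
apply: leq_trans (card_leading_set_step p x ln).
rewrite qfibSS mulnC mulnDl expnD !expnM leq_mul // leq_exp2r ?IH1 ?IH2 //; try lia.
Qed.

Lemma letter_group_lower p n (I : finType) : 1 < #|I| ->
  2 ^ qfib #|I|.-1 n <= #|letter_group p n.+2 I|.
Proof.
move=> I2; have /card_gt0P[x _] : 0 < #|I| by exact: ltnW.
apply: leq_trans (card_leading_set p x (leqnn _) I2) _.
apply: leq_trans (leq_imset_card _ _) _.
by rewrite subset_leq_card // subsetIl.
Qed.

End LowerBound.

(** * Counting the values of a word by cosets *)

Section CountValues.

Variables (gT : finGroupType) (G K L : {group gT}) (k : nat) (w : free_group k).
Hypothesis sLG : (L \subset G)%g.
Hypothesis wKL : forall h h' : 'I_k -> gT, (forall i, h i \in G) ->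
  (forall i, h' i \in G) -> (forall i, h' i \in h i *: K)%g ->
  (word_map w h' \in word_map w h *: L)%g.

(** Each of the [#|G : K| ^ k] tuples of cosets of [K] is allotted one coset of [L], which by [wKL]
    contains the values of [w] at all tuples of representatives. *)
Lemma word_values_cover : (K \subset G)%g -> exists2 A : {set gT},
  forall h : 'I_k -> gT, (forall i, h i \in G) -> word_map w h \in A
  & #|A| <= #|G : K|%g ^ k * #|L|.
Proof.
move=> sKG.
pose C := [set c : {ffun 'I_k -> {set gT}} | c \in ffun_on (mem (lcosets K G))].
pose B (c : {ffun 'I_k -> {set gT}}) := (word_map w (fun i => repr (c i)) *: L)%g.
exists (\bigcup_(c in C) B c)%SET.
  move=> h hG; pose c := [ffun i => (h i *: K)%g].
  apply/bigcupP; exists c.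
    rewrite inE; apply/ffun_onP=> i; rewrite ffunE.
    by apply/lcosetsP; exists (h i).
  have hr i : repr (c i) \in (h i *: K)%g
    by rewrite ffunE; apply: (mem_repr (h i)); exact: lcoset_refl.
  apply: wKL => // i.
    by have := hr i; apply/fintype.subsetP; rewrite -(lcoset_id (hG i)) lcosetS.
  by rewrite lcoset_sym.
apply: leq_trans (_ : \sum_(c in C) #|B c| <= _).
  elim/big_rec2: _ => [|c m S _ le]; first by rewrite cards0.
  by apply: leq_trans (leq_card_setU _ _) _; rewrite leq_add2l.
rewrite (eq_bigr (fun=> #|L|)) => [|c _]; last by rewrite card_lcoset.
by rewrite sum_nat_const cardsE card_ffun_on card_ord card_lcosets.
Qed.

End CountValues.

(** * Finite p-groups in which the word takes few values *)

Lemma group_letter_val (gT : finGroupType) (G : {group gT}) k (h : 'I_k -> gT) a :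
  (forall i, h i \in G) -> letter_val h a \in G.
Proof. by move=> hG; rewrite /letter_val; case: a.2; rewrite ?groupV. Qed.

Lemma group_word_map (gT : finGroupType) (G : {group gT}) k (w : free_group k) h :
  (forall i, h i \in G) -> word_map w h \in G.
Proof.
move=> hG; rewrite /word_map; elim/big_rec: _ => [|a x _ xG]; first exact: group1.
by rewrite groupM // group_letter_val.
Qed.

(** If no such group existed, the orders of the letter groups would be bounded above too tightly for
    the growth of [qfib]. *)
Lemma word_values_small p k (I : finType) (w : free_group k) c :
  prime p -> (forall i, p %| exponent_sum w i)%Z -> 0 < k < #|I| ->
  exists (gT : finGroupType) (G : {group gT}) (x : I -> gT) (A : {set gT}),
    [/\ p.-group%g G, G :=: <<[set x i | i : I]>>%g,
        forall h : 'I_k -> gT, (forall i, h i \in G) -> word_map w h \in A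
      & 2 ^ c * #|A| < #|G|].
Proof.
move=> p_pr pw /andP[k0 kd]; apply: contrapT => noG.
have bound (gT : finGroupType) (G : {group gT}) (x : I -> gT) (A : {set gT}) :
    p.-group%g G -> G :=: <<[set x i | i : I]>>%g ->
    (forall h : 'I_k -> gT, (forall i, h i \in G) -> word_map w h \in A) ->
    #|G| <= 2 ^ c * #|A|.
  move=> pG Gx wA; rewrite leqNgt; apply/negP=> lt; apply: noG.
  by exists gT, G, x, A.
set q := #|I|.-1; have q0 : 0 < q by rewrite /q -subn1 subn_gt0; apply: leq_ltn_trans kd.
have kq : k <= q by rewrite -ltnS prednK // (leq_ltn_trans _ kd).
(* Covering the values by cosets bounds the next index by [2 ^ c] times the [k]-th power of the
   current one. The exponents thus satisfy [a_(m+1) <= c + k a_m] with [k <= q], whence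
   [a_m <= c m q ^ m]. *)
have index_bound n m :
    #|letter_group p n I : letter_group p n I :&: cong_group p n I m.+1|%g
      <= 2 ^ (c * (m * q ^ m)).
  set G := letter_group p n I; set U := cong_group p n I.
  have sGU : G \subset U 1 by exact: letter_group_cong.
  elim: m => [|m IH]; first by rewrite (finset.setIidPl sGU) indexgg expn_gt0.
  pose K := (G :&: U m.+1)%G; pose L := (G :&: U m.+2)%G.
  have wKL (h h' : 'I_k -> _) : (forall i, h i \in G) -> (forall i, h' i \in G) ->
      (forall i, h' i \in h i *: K)%g -> (word_map w h' \in word_map w h *: L)%g.
    move=> hG h'G hh'; rewrite mem_lcoset inE groupM ?groupV ?group_word_map //=.
    rewrite -mem_lcoset; apply: word_map_cong => // i; rewrite ?(fintype.subsetP sGU) //.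
    by have := hh' i; rewrite !mem_lcoset inE => /andP[].
  have [A wA cA] := word_values_cover wKL (subsetIl _ _).
  have pG : p.-group%g G by exact: pgroupS sGU (cong_pgroup _ _ p_pr).
  have := leq_trans (bound _ G _ A pG erefl wA) (leq_mul (leqnn _) cA).
  rewrite -(@Lagrange _ G L) ?subsetIl // mulnC mulnA leq_pmul2r ?cardG_gt0 //.
  move=> le; apply: leq_trans le _.
  rewrite -(leq_exp2r _ _ k0) in IH; apply: leq_trans (leq_mul (leqnn _) IH) _.
  rewrite -expnM -expnD leq_exp2l // -mulnA -mulnS leq_mul2l mulSn; apply/orP; right.
  rewrite -add1n; apply: leq_add; first by rewrite expn_gt0 q0.
  by rewrite -mulnA expnSr leq_mul2l leq_mul2l kq !orbT.
(* The two bounds combine to ['C(l.-1, 2) <= B * (l + 3)], where [q ^ 5] collects [q ^ 2] from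
   [qfib_lower] and [q ^ 3] from the shift by 3. For this [l] the left side is [(B + 5) (2 B + 9)],
   which exceeds [B (2 B + 14)]. *)
pose B := c * q ^ 5; pose l := (2 * B + 10).+1.
have I2 : 1 < #|I| by exact: leq_ltn_trans kd.
have := letter_group_lower p l.+1 I2.
(* Truncation at [l + 3] makes [U (l + 4)] trivial, so this index is the order of the whole
   group. *)
have := index_bound l.+3 l.+3.
have -> : (letter_group p l.+3 I :&: cong_group p l.+3 I l.+4 = 1)%g.
  by rewrite cong_big; apply/trivgP; exact: subsetIr.
rewrite indexg1 => up low; have := leq_trans low up.
rewrite leq_exp2l // => le; have := leq_trans (qfib_lower l q0) (leq_mul (leqnn _) le).
have -> : q ^ 2 * (c * (l.+3 * q ^ l.+3)) = B * l.+3 * q ^ l.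
  by rewrite /B -[l.+3]addn3 expnD (_ : 5 = 2 + 3) // expnD; lia.
rewrite leq_pmul2r ?expn_gt0 ?q0 // leqNgt => /negP; apply.
rewrite /l [_.+1.-1]/= bin2; clear; move: B => b.
have -> : (2 * b + 10) * (2 * b + 10).-1 = ((b + 5) * (2 * b + 9)).*2 by nia.
by rewrite doubleK; nia.
Qed.

Local Open Scope classical_set_scope.
Local Open Scope group_scope.

(** * Clopen neighbourhoods in compact totally disconnected spaces *)

Definition quasicomponent (T : topologicalType) (x : T) : set T :=
  \bigcap_(U in [set U : set T | clopen U /\ U x]) U.

(** Otherwise the clopen sets around [x] leave a proper filter on the compact complement of [W]. A
    cluster point of it lies in every such clopen set, hence in the quasicomponent and in [W]. *)
Lemma quasicomponent_clopen (T : topologicalType) (x : T) (W : set T) :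
  compact [set: T] -> open W -> quasicomponent x `<=` W ->
  exists2 U, clopen U /\ U x & U `<=` W.
Proof.
move=> cT oW QW; apply: contrapT => noU.
have cW : compact (~` W).
  by apply: subclosed_compact cT _ => //; exact: open_closedC.
pose B := [set U : set T | clopen U /\ U x].
have BP U : B U -> U `&` ~` W !=set0.
  move=> BU; apply/set0P/eqP => /disjoints_subset; rewrite setCK => UW.
  by apply: noU; exists U.
have PF : ProperFilter (filter_from B (fun U => U `&` ~` W)).
  apply: filter_from_proper => //; apply: filter_from_filter.
    by exists setT; split => //; exact: clopenT.
  move=> U V [cU Ux] [cV Vx]; exists (U `&` V).
    by split; [exact: clopenI | split].
  by move=> y [[Uy Vy] nW]; split; split.
have [|y [nWy cly]] := cW _ PF.
  by exists setT; [split => //; exact: clopenT | move=> y []].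
have [U [cU Ux] nUy] : exists2 U, clopen U /\ U x & ~ U y.
  apply: contrapT => noV; apply: nWy; apply: QW => U [cU Ux].
  by apply: contrapT => nUy; apply: noV; exists U.
have [||z [[Uz _] nUz]] := cly (U `&` ~` W) (~` U); first by exists U.
  by apply: open_nbhs_nbhs; split => //; apply: closed_openC; case: cU.
exact: nUz.
Qed.

(* In a compact Hausdorff space quasicomponents are connected. *)
Lemma totally_disconnected_zero_dimensional (T : topologicalType) :
  compact [set: T] -> hausdorff_space T -> totally_disconnected [set: T] ->
  zero_dimensional T.
Proof.
move=> cT hT tdT x y; apply: contra_neqP => noU.
have Qy : quasicomponent x y.
  by move=> U [cU Ux]; apply: contrapT => nUy; apply: noU; exists U.
have Qcl : closed (quasicomponent x) by apply: closed_bigI => U [[]].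
have nT := compact_normal hT cT.
(* Normality gives disjoint open sets [V] around [P] and [W] around [R]. A clopen [U] around [x]
   inside their union meets [V] in a clopen set, which must contain the whole quasicomponent and
   leaves no room for [R]. *)
have sep (P R : set T) : closed P -> closed R -> P `&` R = set0 -> P x ->
    P `|` R = quasicomponent x -> R = set0.
  move=> cP cR PR Px PRQ.
  have sP : set_nbhs P (~` R).
    by apply/set_nbhsP; exists (~` R); split => //;
      [exact: closed_openC | exact/disjoints_subset].
  have [V0 /set_nbhsP[V [oV PV VV0]] V0R] := nT P cP _ sP.
  pose W := ~` closure V0.
  have oW : open W by apply: closed_openC; exact: closed_closure.
  have RW : R `<=` W by move=> z Rz /V0R; apply.
  have VW z : V z -> W z -> False.
    by move=> /VV0 Vz; apply; exact: subset_closure.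
  have [|U [[oU cU] Ux] UVW] := @quasicomponent_clopen _ x _ cT (openU oV oW).
    by rewrite -PRQ => z [/PV|/RW]; [left|right].
  have QV : quasicomponent x `<=` U `&` V.
    move=> z; apply; split; last by split => //; exact: PV.
    split; first exact: openI.
    have -> : U `&` V = U `&` ~` W.
      apply/seteqP; split=> t [Ut]; first by split => // Wt; exact: VW Wt.
      by move=> nWt; split => //; case: (UVW _ Ut).
    by apply: closedI => //; exact: open_closedC.
  apply/seteqP; split=> // z Rz; have /QV[_ Vz] : quasicomponent x z by rewrite -PRQ; right.
  exact: VW Vz (RW _ Rz).
have Qcon : connected (quasicomponent x).
  move=> B [b Bb] [C oC BC] [D cD BD].
  have cB : closed B by rewrite BD; exact: closedI.
  have cB' : closed (quasicomponent x `&` ~` C).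
    by apply: closedI => //; exact: open_closedC.
  have dis : B `&` (quasicomponent x `&` ~` C) = set0.
    by rewrite BC; apply/seteqP; split => // z [[_ ?] []].
  have cup : B `|` (quasicomponent x `&` ~` C) = quasicomponent x.
    by rewrite BC -setIUr setUv setIT.
  have Qx : quasicomponent x x by move=> U [].
  have [Cx|nCx] := pselect (C x).
    have R0 : quasicomponent x `&` ~` C = set0.
      by apply: sep cB cB' dis _ cup; rewrite BC.
    by rewrite -[RHS]cup R0 setU0.
  suff B0 : B = set0 by rewrite B0 in Bb.
  by apply: (sep _ _ cB' cB _ _ _) => //; [rewrite setIC | rewrite setUC].
have : connected_component [set: T] x y.
  by apply: (connected_component_max (B := quasicomponent x)) => // U [].
by rewrite tdT.
Qed.

(** * Compact topological groups: word images and open normal subgroups *)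

Section TopGroup.

Variable G : topGroupType.

Lemma cvgMg (T : Type) (F : set_system T) (FF : Filter F) (f g : T -> G)
    (a b : G) :
  f @ F --> a -> g @ F --> b -> (fun x => f x * g x) @ F --> a * b.
Proof.
apply: (@continuous2_cvg _ _ _ _ _ _ f g (fun x y => x * y)).
exact: (mulg_continuous (a, b)).
Qed.

Lemma continuousM_group (T : topologicalType) (f g : T -> G) :
  continuous f -> continuous g -> continuous (fun x => f x * g x).
Proof. by move=> cf cg x; apply: cvgMg; [exact: cf | exact: cg]. Qed.

Lemma continuousV_group (T : topologicalType) (f : T -> G) :
  continuous f -> continuous (fun x => (f x)^-1).
Proof. by move=> cf x; apply: continuous_comp; [exact: cf | exact: invg_continuous]. Qed.

Lemma word_map_continuous k (w : free_group k) :
  continuous (fun h : prod_topology (fun _ : 'I_k => G) => word_map w h).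
Proof.
have ext (f g : prod_topology (fun _ : 'I_k => G) -> G) :
  f =1 g -> continuous f -> continuous g by move=> /funext->.
rewrite /word_map; elim: (fword w) => [|a s IH].
  by apply: (ext (cst 1)) => [h|]; [rewrite big_nil | exact: cst_continuous].
apply: (ext (fun h => letter_val h a * \prod_(b <- s) letter_val h b)).
  by move=> h; rewrite big_cons.
apply: continuousM_group => //; rewrite /letter_val.
have pc : continuous (fun h : prod_topology (fun _ : 'I_k => G) => h a.1).
  exact: (@proj_continuous _ (fun=> G) a.1).
by case: a.2; [apply: continuousV_group|].
Qed.

Hypothesis cG : compact [set: G].

Lemma compact_word_image k (w : free_group k) : compact (word_image G w).
Proof.
have -> : word_image G w = (fun h : prod_topology (fun _ : 'I_k => G) => word_map w h) @` setT.
  by apply/seteqP; split=> [_ [h ->]|_ [h _ <-]]; exists h.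
apply: continuous_compact.
  by apply: continuous_subspaceT; exact: word_map_continuous.
have := @tychonoff 'I_k (fun=> G) (fun=> setT) (fun=> cG).
by congr (compact _); apply/seteqP; split.
Qed.

(* For clopen [U], compactness makes this normal subgroup open. *)
Definition clopen_core (U : set G) : set G :=
  [set x | forall a b, U (a * x * b) <-> U (a * b)].

Lemma clopen_core_normal U : normal_subgroup (clopen_core U).
Proof.
split.
- by move=> a b; rewrite mulg1.
- move=> x y Nx Ny a b; have := Nx a (y^-1 * b); have := Ny (a * y^-1) b.
  by rewrite !mulgA mulgVK => H1 H2; apply: iff_trans H2 (iff_sym H1).
- move=> x y Nx a b; rewrite conjgE; have := Nx (a * y^-1) (y * b).
  by rewrite !mulgA mulgKV.
Qed.

Lemma clopen_core_sub (U : set G) : U 1 -> clopen_core U `<=` U.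
Proof. by move=> U1 x /(_ 1 1); rewrite !mul1g !mulg1 => ->. Qed.

(** Membership of [a x b] and of [a b] in a clopen set is locally constant in [(a, b, x)];
    compactness of [G * G] yields one neighbourhood of [x] that serves all pairs. *)
Lemma clopen_core_open (U : set G) : clopen U -> open (clopen_core U).
Proof.
move=> [oU cU]; rewrite openE => x Nx; rewrite /interior.
have cGG : near_covering [set: G * G].
  by apply/compact_near_coveringP; rewrite -setXTT; exact: compact_setX.
pose P (x' : G) (ab : G * G) := U (ab.1 * x' * ab.2) <-> U (ab.1 * ab.2).
suff : \forall y \near x, [set: G * G] `<=` P y.
  by apply: filterS => x' Px a b; exact: (Px (a, b)).
apply: cGG => -[a b] _.
have ax : (fun z : (G * G) * G => z.1.1 * z.2 * z.1.2) @ nbhs ((a, b), x) --> a * x * b.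
  have c1 : (fun z : (G * G) * G => z.1.1) @ nbhs ((a, b), x) --> a.
    by apply: (@cvg_comp _ _ _ fst fst _ _ _ cvg_fst); exact: cvg_fst.
  have c2 : (fun z : (G * G) * G => z.1.2) @ nbhs ((a, b), x) --> b.
    by apply: (@cvg_comp _ _ _ fst snd _ _ _ cvg_fst); exact: cvg_snd.
  by apply: cvgMg c2; apply: cvgMg c1 _; exact: cvg_snd.
have ab : (fun z : (G * G) * G => z.1.1 * z.1.2) @ nbhs ((a, b), x) --> a * b.
  have c1 : (fun z : (G * G) * G => z.1.1) @ nbhs ((a, b), x) --> a.
    by apply: (@cvg_comp _ _ _ fst fst _ _ _ cvg_fst); exact: cvg_fst.
  have c2 : (fun z : (G * G) * G => z.1.2) @ nbhs ((a, b), x) --> b.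
    by apply: (@cvg_comp _ _ _ fst snd _ _ _ cvg_fst); exact: cvg_snd.
  exact: cvgMg c1 c2.
have [Uab|nUab] := pselect (U (a * b)).
  have Uaxb : U (a * x * b) by apply/Nx.
  have n1 := ax U (open_nbhs_nbhs (conj oU Uaxb)).
  have n2 := ab U (open_nbhs_nbhs (conj oU Uab)).
  apply: (@filterS2 _ (nbhs ((a, b), x)) _ _ _ _ _ n1 n2).
  by move=> [[a' b'] x'] /= H1 H2; split.
have nUaxb : ~ U (a * x * b) by move/(Nx a b).
have oU' := closed_openC cU.
have n1 := ax (~` U) (open_nbhs_nbhs (conj oU' nUaxb)).
have n2 := ab (~` U) (open_nbhs_nbhs (conj oU' nUab)).
apply: (@filterS2 _ (nbhs ((a, b), x)) _ _ _ _ _ n1 n2).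
by move=> [[a' b'] x'] /= H1 H2; split.
Qed.

End TopGroup.

(** * Powers in pro-p groups and exponent sums *)

Section ProPowers.

(** Left multiplication by [g] permutes the [m] cosets. By normality a power of it fixing one coset
    fixes all, so all orbits have the length of its order, which therefore divides [m]. *)
Lemma expg_has_index (G : groupType) (N : set G) m g :
  normal_subgroup N -> has_index N m -> N (g ^+ m).
Proof.
move=> [N1 Ndiv NJ] idx.
have NV x : N x -> N x^-1 by move=> Nx; have := Ndiv _ _ N1 Nx; rewrite div1g.
have NM x y : N x -> N y -> N (x * y).
  by move=> Nx Ny; have := Ndiv _ _ Nx (NV _ Ny); rewrite invgK.
have cosetE x y : lcoset_set x N = lcoset_set y N <-> N (x^-1 * y).
  split=> [E|Nxy].
    have : lcoset_set y N y by exists 1; rewrite ?mulg1.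
    by rewrite -E => -[z Nz <-]; rewrite mulKg.
  apply/seteqP; split=> _ [z Nz <-].
    exists (y^-1 * x * z); last by rewrite -mulgA mulKVg.
    by apply: NM => //; have := NV _ Nxy; rewrite invgM invgK.
  by exists (x^-1 * y * z); [apply: NM | rewrite -mulgA mulKVg].
have /card_set_bijP[f [fun_f inj_f surj_f]] := idx.
have fm x : (f (lcoset_set x N) < m)%N by apply: (fun_f (lcoset_set x N)); exists x.
pose F x : 'I_m := Ordinal (fm x).
have FE x y : F x = F y <-> N (x^-1 * y).
  rewrite -cosetE; split=> [/(congr1 val) /= E|E].
    by apply: inj_f => //; rewrite inE; [exists x | exists y].
  by apply: val_inj; rewrite /= E.
have Fsurj (i : 'I_m) : exists x, F x = i.
  have [|_ [x _ <-] fx] := surj_f i; first exact: ltn_ord.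
  by exists x; apply: val_inj.
have [r rP] := choice Fsurj.
pose sg (y : G) (i : 'I_m) := F (y * r i).
have sgF y x : sg y (F x) = F (y * x).
  apply/FE; rewrite invgM -mulgA mulKg; exact/FE/rP.
have sg_inj : injective (sg g).
  move=> i j /FE; rewrite invgM -mulgA mulKg => /FE.
  by rewrite !rP.
pose s := perm sg_inj.
have sX j x : (s ^+ j)%g (F x) = F (g ^+ j * x).
  elim: j => [|j IH]; first by rewrite perm1 mul1g.
  by rewrite expgSr permM IH permE sgF mulgA -expgS.
have stab (x : 'I_m) : 'C_<[s]>[x | 'P]%g = 1%g.
  apply/trivgP/fintype.subsetP=> t /setIP[/cycleP[j ->]] /astab1P; rewrite inE.
  rewrite /= /aperm -(rP x) sX => /FE; rewrite invgM -mulgA => Nj.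
  have Ngj : N (g ^+ j)^-1.
    by have := NJ _ (r x)^-1 Nj; rewrite conjgE invgK !mulgA mulgV mul1g mulgK.
  apply/eqP/permP=> i; rewrite -(rP i) sX perm1; apply/FE.
  by rewrite invgM -mulgA -conjgE; apply: NJ.
have dv : #[s]%g %| m.
  have acts : [acts <[s]>%g, on [set: 'I_m]%SET | 'P].
    by apply/actsP=> t _ i; rewrite !inE.
  have orb A : A \in orbit 'P <[s]>%g @: [set: 'I_m]%SET -> #|A| = #[s]%g.
    by move=> /imsetP[x _ ->]; rewrite card_orbit stab indexg1.
  have := card_uniform_partition orb (orbit_partition acts).
  by rewrite cardsT card_ord => mE; apply/dvdnP; eexists; exact: mE.
have /FE : F (g ^+ m) = F 1.
  have sm : (s ^+ m)%g = 1%g by apply/eqP; rewrite -order_dvdn.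
  by have := sX m 1; rewrite mulg1 => <-; rewrite sm perm1.
by rewrite mulg1 => /NV; rewrite invgK.
Qed.

End ProPowers.

(** The set of [m]-th powers is closed, so if it missed [g] it would miss [g N] for some open normal
    [N] of index [p ^ s]. Bezout, [a m = b p ^ s + 1], gives the [m]-th power [g ^ (a m)] in
    [g N]. *)
Lemma pro_p_power_surj p m (G : topGroupType) :
  prime p -> pro_p p G -> ~~ (p %| m) -> forall g : G, exists x, x ^+ m = g.
Proof.
move=> p_pr [[cG hG tdG] Gp] pm g; apply: contrapT => nog.
have pw : continuous (fun x : G => x ^+ m).
  elim: m {pm nog} => [|m IH].
    by rewrite (_ : (fun _ => _) = fun=> 1); [move=> x; exact: cvg_cst | apply/funext].
  rewrite (_ : (fun _ => _) = fun x : G => x * x ^+ m); last first.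
    by apply/funext=> x; rewrite expgS.
  by apply: continuousM_group IH => x; exact: cvg_id.
pose E := (fun x : G => x ^+ m) @` setT.
have cE : closed E.
  apply: compact_closed => //; apply: continuous_compact cG.
  exact: continuous_subspaceT.
have oV : nbhs (1 : G) [set y | ~ E (g * y)].
  have gc : (fun y : G => g * y) @ (1 : G) --> g * 1.
    by apply: cvgMg; [exact: cvg_cst | exact: cvg_id].
  apply: (gc (~` E)); apply: open_nbhs_nbhs; split; first exact: closed_openC.
  by rewrite mulg1 => -[x _ xg]; apply: nog; exists x.
have zG := totally_disconnected_zero_dimensional cG hG tdG.
have [U [U1 cU] UV] := zero_dimensional_cvg (x := 1) hG zG cG oV.
have nN := clopen_core_normal U; have oN := clopen_core_open cG cU.
have [s idx] := Gp _ oN nN.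
have m0 : 0 < m by rewrite lt0n; apply: contraNneq pm => ->; rewrite dvdn0.
have [a b E1 _] := egcdnP (p ^ s) m0.
have cop : coprime m (p ^ s) by rewrite coprimeXr // coprime_sym prime_coprime.
have Ng : clopen_core U (g ^+ (b * p ^ s)).
  rewrite mulnC expgM; have Ns := expg_has_index g nN idx.
  have [N1 Ndiv _] := nN; elim: (b) => [|j IH]; first by rewrite expg0.
  rewrite expgSr -[X in _ * X]invgK; apply: (Ndiv) => //.
  by rewrite -div1g; apply: Ndiv.
apply: (UV _ (clopen_core_sub U1 Ng)); exists (g ^+ a) => //.
by rewrite -expgM E1 (eqP cop) addn1 expgS.
Qed.

Lemma word_map_single k (G : groupType) (w : seq (letter k)) (i : 'I_k) (y : G) :
  \prod_(a <- w) letter_val (fun j => if j == i then y else 1) a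
    = y ^+ count (pred1 (i, false)) w * y ^- count (pred1 (i, true)) w.
Proof.
elim: w => [|[j b] w IH]; first by rewrite big_nil /= invg1 mulg1.
rewrite big_cons IH /letter_val /= !xpair_eqE; case: eqP => _ /=; last first.
  by case: b; rewrite ?invg1 mul1g.
case: b; rewrite /= ?add0n ?add1n; last by rewrite expgS mulgA.
rewrite [y ^+ (_.+1)]expgSr invgM !mulgA; congr (_ * _).
exact/commute_sym/commuteV/commute_sym/commuteX.
Qed.

Lemma nonsurj_exponent_sum p k (w : free_group k) (G : topGroupType) :
  prime p -> pro_p p G ->
  ~ (forall g : G, exists h : 'I_k -> G, word_map w h = g) ->
  forall i, (p %| exponent_sum w i)%Z.
Proof.
move=> p_pr pG nsurj i; apply: contrapT => /negP npw; apply: nsurj => g.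
pose P := count (pred1 (i, false)) w; pose Q := count (pred1 (i, true)) w.
have wE y : word_map w (fun j => if j == i then y else 1) = y ^+ P * y ^- Q.
  exact: word_map_single.
have eE : exponent_sum w i = (P%:Z - Q%:Z)%R.
  rewrite /exponent_sum /P /Q; elim: (fword w) => [|[j b] s IH]; first by rewrite big_nil.
  rewrite big_cons /= !xpair_eqE IH; case: eqP => _ //=; case: b => /=;
    rewrite ?add0n ?add1n ?intS; ring.
(* Surjectivity of powers is available for natural exponents, so a negative exponent sum is treated
   by substituting an inverse. *)
rewrite eE in npw; have [QP|/ltnW PQ] := leqP Q P.
  have [|x xg] := @pro_p_power_surj p (P - Q) G p_pr pG _ g.
    by move: npw; rewrite subzn.
  exists (fun j => if j == i then x else 1); rewrite wE -xg.
  by rewrite -{1}(subnK QP) expgnDr mulgK.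
have [|x xg] := @pro_p_power_surj p (Q - P) G p_pr pG _ g.
  by move: npw; rewrite dvdzE distnEr.
exists (fun j => if j == i then x^-1 else 1); rewrite wE -xg.
by rewrite !expVgn invgK -{1}(subnKC PQ) expgnDr mulKg.
Qed.

(** * Finite p-groups as discrete pro-p groups *)

Definition discrete_group (gT : finGroupType) : Type := gT.
HB.instance Definition _ (gT : finGroupType) := Group.copy (discrete_group gT) gT.
HB.instance Definition _ (gT : finGroupType) := Finite.copy (discrete_group gT) gT.
HB.instance Definition _ (gT : finGroupType) :=
  isPointed.Build (discrete_group gT) (1 : gT).
HB.instance Definition _ (gT : finGroupType) :=
  hasNbhs.Build (discrete_group gT) principal_filter.
HB.instance Definition _ (gT : finGroupType) :=
  Discrete_ofNbhs.Build (discrete_group gT) erefl.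

Section DiscreteGroup.

Variable gT : finGroupType.

Lemma discrete_mulg_continuous :
  continuous (fun xy : discrete_group gT * discrete_group gT => xy.1 * xy.2).
Proof.
move=> [x y]; apply/discrete_cvg.
have : nbhs (x, y) ([set x] `*` [set y]).
  by exists ([set x], [set y]) => //; split; exact: discrete_set1.
by apply: filterS => -[x' y'] /= [-> ->].
Qed.

Lemma discrete_invg_continuous : continuous (fun x : discrete_group gT => x^-1).
Proof.
move=> x; apply/discrete_cvg.
by apply: (filterS _ (discrete_set1 x)) => x' /= ->.
Qed.

HB.instance Definition _ := isTopologicalGroup.Build (discrete_group gT)
  discrete_mulg_continuous discrete_invg_continuous.

Lemma card_set_finset (T : finType) (A : {set T}) : ([set` A] #= `I_#|A|)%card.
Proof.
apply/card_set_bijP; exists (fun x => index x (enum A)); split.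
- by move=> x /= xA; rewrite cardE index_mem mem_enum.
- move=> x y; rewrite !inE /= => xA yA; apply: index_inj; rewrite ?mem_enum //.
- move=> i /= iA; have /card_gt0P[x0 _] : 0 < #|A| by exact: leq_ltn_trans iA.
  exists (nth x0 (enum A) i); first by rewrite /= -mem_enum mem_nth // -cardE.
  by rewrite index_uniq ?enum_uniq // -cardE.
Qed.

Lemma discrete_has_index (N : set (discrete_group gT)) :
  normal_subgroup N -> exists2 m, has_index N m & m %| #|gT|.
Proof.
move=> [N1 Ndiv _].
pose Nset : {set gT} := [set x : gT | `[< N x >]]%SET.
have NsetP x : x \in Nset <-> N x by rewrite finset.in_set; split=> /asboolP.
have gN : group_set Nset.
  apply/group_setP; split=> [|x y /NsetP Nx /NsetP Ny]; apply/NsetP => //.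
  by have := Ndiv x _ Nx (Ndiv _ _ N1 Ny); rewrite mul1g invgK.
pose K := Group gN.
exists #|lcosets K [set: gT]%SET|; last first.
  by rewrite card_lcosets -cardsT dvdn_indexg.
rewrite /has_index.
have -> : range (fun x : discrete_group gT => lcoset_set x N)
    = (fun B : {set gT} => [set` B]) @` [set` lcosets K [set: gT]%SET].
  have E x : lcoset_set x N = [set` (x *: K)%g].
    apply/seteqP; split=> [_ [y Ny <-]|y].
      by rewrite /= mem_lcoset mulKg; apply/NsetP.
    by rewrite /= mem_lcoset => /NsetP Ny; exists (x^-1 * y); rewrite ?mulKVg.
  apply/seteqP; split=> [_ [x _ <-]|_ [B /= /lcosetsP[x _ ->] <-]].
    by exists (x *: K)%g; [apply/lcosetsP; exists x | rewrite E].
  by exists x; rewrite ?E.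
apply: (@card_eq_trans _ _ _ _ [set` lcosets K [set: gT]%SET]); last exact: card_set_finset.
apply: inj_card_eq => B C _ _ /seteqP[BC CB].
by apply/finset.setP=> x; apply/idP/idP; [exact: BC | exact: CB].
Qed.

Lemma discrete_pro_p p : prime p -> p.-group [set: gT]%SET -> pro_p p (discrete_group gT).
Proof.
move=> p_pr pG; split=> [|N _ nN].
  split; [exact/finite_compact/finite_finset | exact: discrete_hausdorff |].
  exact/zero_dimension_totally_disconnected/discrete_zero_dimension.
have [m idx md] := discrete_has_index nN.
have [e cG] := p_natP pG; rewrite cardsT in cG.
move: md; rewrite cG => /(dvdn_pfactor _ _ p_pr)[s _ ms].
by exists s; rewrite -ms.
Qed.

End DiscreteGroup.

(** * Haar measure and finite quotients *)

Import Order.TTheory Num.Theory.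

Lemma word_map_morph k (G K : groupType) (phi : G -> K)
    (w : free_group k) (h : 'I_k -> G) :
  monoid_morphism phi -> phi (word_map w h) = word_map w (phi \o h).
Proof.
move=> [phi1 phiM].
have phiV x : phi x^-1 = (phi x)^-1.
  by apply: (mulgI (phi x)); rewrite -phiM !mulgV.
rewrite /word_map; elim: (fword w) => [|a s IH]; first by rewrite !big_nil.
rewrite !big_cons phiM IH; congr (_ * _).
by rewrite /letter_val; case: a.2.
Qed.

Section HaarQuotient.

Variables (R : realType) (H : topGroupType) (mu : probability (borel H) R).
Hypothesis haar : normalized_haar mu.

Lemma open_borel (A : set H) : open A -> measurable (A : set (borel H)).
Proof. by move=> oA; apply: sub_sigma_algebra. Qed.

Lemma closed_borel (A : set H) : closed A -> measurable (A : set (borel H)).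
Proof.
by move=> cA; rewrite -[A]setCK; apply: measurableC; apply: open_borel; exact: closed_openC.
Qed.

Variables (gT : finGroupType) (phi : H -> discrete_group gT).
Hypotheses (cphi : continuous phi) (mphi : monoid_morphism phi).
Hypothesis sphi : forall a, exists h, phi h = a.

(** The fibres of [phi] are translates of its kernel, so they share one measure [c]; they partition
    [H], so [#|gT| * c = 1]. *)
Lemma haar_preimage (A : {set gT}) :
  mu (phi @^-1` [set` A]) = (#|A|%:R / #|gT|%:R)%:E.
Proof.
pose c := mu (phi @^-1` [set 1]).
have mB (B : set (discrete_group gT)) : measurable (phi @^-1` B : set (borel H)).
  by apply: open_borel; move/continuousP: cphi; apply; exact: discrete_open.
have fiber a : mu (phi @^-1` [set a]) = c.
  have [h ha] := sphi a; rewrite /c -(haar h (mB [set 1])); congr (mu _).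
  have [phi1 phiM] := mphi.
  apply/seteqP; split=> [x /= xa|_ [y /= y1 <-]]; last by rewrite phiM y1 ha mulg1.
  exists (h^-1 * x); last by rewrite mulKVg.
  by apply: (mulgI (phi h)); rewrite -phiM mulKVg ha mulg1.
have cE : c = (fine c)%:E by rewrite fineK // fin_num_measure.
have muA (B : {set gT}) : mu (phi @^-1` [set` B]) = (#|B|%:R * fine c)%:E.
  have -> : phi @^-1` [set` B] = \bigcup_(a in [set` enum B]) (phi @^-1` [set a]).
    apply/seteqP; split=> [x xB|x [a /= aB xa]]; last by rewrite /= xa -mem_enum.
    by exists (phi x) => //=; rewrite mem_enum.
  rewrite measure_fin_bigcup //; last first.
    by move=> a b _ _ [x [/= -> ->]].
  rewrite -fsbig_seq ?enum_uniq // big_enum.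
  rewrite (eq_bigr (fun=> (fine c)%:E)) => [|a _]; last exact: etrans (fiber a) cE.
  by rewrite sumEFin GRing.sumr_const GRing.mulr_natl.
have cT : (#|gT|%:R * fine c = 1)%R.
  have := muA [set: gT]%SET; rewrite cardsT (_ : phi @^-1` _ = setT).
    by rewrite probability_setT => -[].
  by apply/seteqP; split=> // x _ /=; rewrite finset.in_setT.
have g0 : (#|gT|%:R != 0 :> R)%R by rewrite pnatr_eq0 -lt0n; apply/card_gt0P; exists 1.
rewrite muA; congr (_ %:E).
by rewrite -[fine c](GRing.mulfK g0) [(fine c * _)%R]GRing.mulrC cT GRing.mul1r.
Qed.

End HaarQuotient.

(** The universal property sends the basis to [y], and the range is a subgroup containing these
    generators. *)
Lemma free_pro_p_onto_pgroup p d (H : topGroupType) (gT : finGroupType)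
    (y : 'I_d -> gT) :
  prime p -> free_pro_p p d H -> p.-group [set: gT]%SET ->
  [set: gT]%SET = <<[set y i | i : 'I_d]>>%g ->
  exists phi : H -> discrete_group gT,
    [/\ continuous phi, monoid_morphism phi & forall a, exists h, phi h = a].
Proof.
move=> p_pr [x [_ Hx]] pG genG.
have [phi [[cphi mphi phix] _]] := Hx _ (discrete_pro_p p_pr pG) y.
exists phi; split=> // a; have [phi1 phiM] := mphi.
pose S : {set gT} := [set b : gT | `[< exists h, phi h = b >]]%SET.
have SP b : b \in S <-> exists h, phi h = b by rewrite finset.in_set; split=> /asboolP.
have gS : group_set S.
  apply/group_setP; split=> [|b c /SP[h hb] /SP[l lc]]; apply/SP.
    by exists 1.
  by exists (h * l); rewrite phiM hb lc.
have : <<[set y i | i : 'I_d]>>%g \subset Group gS.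
  rewrite gen_subG; apply/fintype.subsetP=> _ /imsetP[i _ ->].
  by apply/SP; exists (x i).
rewrite -genG => /fintype.subsetP/(_ a); rewrite finset.in_setT => /(_ isT).
by move/SP.
Qed.

(** * The word image has arbitrarily small measure *)

Theorem theorem1p1 (R : realType) (p k d : nat) (w : free_group k)
    (H : topGroupType) (mu : probability (borel H) R) :
  prime p -> (1 <= k)%N -> free_pro_p p d H -> normalized_haar mu ->
  ~ (forall g : H, exists h : 'I_k -> H, word_map w h = g) ->
  (k + 1 <= d)%N ->
  mu (word_image H w) = 0%E.
Proof.
move=> p_pr k0 freeH haar nsurj kd.
have [x [pH _]] := freeH; have [[cH hH _] _] := pH.
have pw := nonsurj_exponent_sum p_pr pH nsurj.
have mW : measurable (word_image H w : set (borel H)).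
  by apply: closed_borel; apply: compact_closed => //; exact: compact_word_image.
pose r := fine (mu (word_image H w)).
have rE : mu (word_image H w) = r%:E by rewrite fineK // fin_num_measure.
have bound c : (r <= (2 ^ c)%:R^-1)%R.
  have kd' : 0 < k < #|'I_d| by rewrite card_ord k0 -addn1.
  have [gT [G [y [A [pG genG wA ltA]]]]] := word_values_small c p_pr pw kd'.
  (* The quotient map must land in a whole type, so [G] is replaced by [subg_of G]. *)
  pose y' i : subg_of G := subg G (y i).
  have yG i : y i \in G by rewrite genG mem_gen // imset_f.
  have gen' : [set: subg_of G]%SET = <<[set y' i | i : 'I_d]>>%g.
    have sYG : [set y i | i : 'I_d]%SET \subset G.
      by apply/fintype.subsetP=> _ /imsetP[i _ ->].
    rewrite -[LHS](im_subg G) {2}genG morphim_gen // morphimEsub //.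
    by rewrite -imset_comp.
  have cG : #|[set: subg_of G]%SET| = #|G|.
    by have := card_injm (injm_subg G) (subxx G); rewrite im_subg.
  have pG' : p.-group [set: subg_of G]%SET by rewrite /pgroup cG.
  have [phi [cphi mphi sphi]] := free_pro_p_onto_pgroup p_pr freeH pG' gen'.
  pose A' : {set subg_of G} := [set a | sgval a \in A]%SET.
  have WA : word_image H w `<=` phi @^-1` [set` A'].
    move=> _ [h ->] /=; rewrite finset.inE word_map_morph //.
    rewrite (@word_map_morph _ _ _ (sgval : subg_of G -> gT)); last first.
      by split=> // u v; exact: sgvalM.
    by apply: wA => i; exact: subgP.
  have cA' : #|A'| <= #|A|.
    rewrite -(card_imset A' (@subg_inj _ G)); apply: subset_leq_card.
    by apply/fintype.subsetP=> _ /imsetP[a + ->]; rewrite finset.inE.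
  have mA' : measurable (phi @^-1` [set` A'] : set (borel H)).
    by apply: open_borel; move/continuousP: cphi; apply; exact: discrete_open.
  have : (mu (word_image H w) <= mu (phi @^-1` [set` A']))%E.
    by apply: le_measure => //; rewrite inE.
  rewrite rE (haar_preimage haar cphi mphi sphi) lee_fin => /le_trans; apply.
  rewrite -cardsT cG ler_pdivrMr ?ltr0n ?cardG_gt0 // ler_pdivlMl ?ltr0n ?expn_gt0 //.
  rewrite -GRing.natrM ler_nat ltnW // (leq_ltn_trans _ ltA) //.
  by rewrite leq_mul2l cA' orbT.
have r0 : (0 <= r)%R by rewrite -lee_fin -rE measure_ge0.
rewrite rE; congr (_ %:E); apply/eqP; rewrite eq_le r0 andbT leNgt; apply/negP=> rp.
(* For [c] this successor, [2 ^ c > c > 1 / r], against [r <= 2 ^ -c]. *)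
have := bound (Num.truncn r^-1).+1.
rewrite leNgt => /negP; apply; rewrite invf_plt ?posrE ?ltr0n ?expn_gt0 //.
apply: lt_le_trans (truncnS_gt _) _; rewrite ler_nat.
by rewrite ltnW // ltn_expl.
Qed.
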